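(* Let $(\Omega,\Sigma,\mu)$ be a measure space, $\rho:\Omega\to(0,\infty)$ measurable, $M>m>0$, and let $f,g,h\in L^2_\rho(\Omega)$ with $h(x)\neq 0$ for a.e. $x\in\Omega$, be such that the functions $$M\cdot\frac{g}{h}-\frac{f}{h},\qquad \frac{f}{h}-m\cdot\frac{g}{h}$$ are synchronous on $\Omega$. For $u,v\in L^2_\rho(\Omega)$ write $$\Gamma(u,v):=\det\begin{pmatrix}\int_\Omega\rho uv\,d\mu & \int_\Omega\rho uh\,d\mu\\ \int_\Omega\rho vh\,d\mu & \int_\Omega\rho h^2\,d\mu\end{pmatrix}.$$ Then $$0\le \Gamma(f,f)\,\Gamma(g,g)-\Gamma(f,g)^2\le \frac14(M-m)^2\,\Gamma(g,g)^2-\left|\frac{m+M}{2}\,\Gamma(g,g)-\Gamma(f,g)\right|^2\ \left(\le\frac14(M-m)^2\,\Gamma(g,g)^2\right).$$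
   Context: $(\Omega,\Sigma,\mu)$ consists of a set $\Omega$, a $\sigma$-algebra $\Sigma$ of subsets of $\Omega$ and a countably additive positive measure $\mu$ on $\Sigma$ with values in $\mathbb{R}\cup\{\infty\}$. For measurable $\rho:\Omega\to(0,\infty)$, $L^2_\rho(\Omega)$ is the Hilbert space of real-valued measurable functions $f$ on $\Omega$ with $\int_\Omega\rho(s)|f(s)|^2\,d\mu(s)<\infty$. A pair of real-valued functions $(q,p)$ on $\Omega$ is synchronous if $(q(x)-q(y))(p(x)-p(y))\ge 0$ for a.e. $x,y\in\Omega$. *)

(* Defs.v *)
From mathcomp Require Import all_boot all_order all_algebra.
From mathcomp Require Import all_classical all_reals all_analysis.

Set Implicit Arguments.
Unset Strict Implicit.
Unset Printing Implicit Defensive.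

Import Order.TTheory GRing.Theory Num.Theory.
Import numFieldNormedType.Exports.

Local Open Scope classical_set_scope.
Local Open Scope ring_scope.

(* Membership of a function (not of its a.e.-class) in the weighted L^2 space:
   everything below is stated for representatives. *)
Definition weightedL2 (d : measure_display) (T : measurableType d)
    (R : realType) (mu : {measure set T -> \bar R}) (rho f : T -> R) : Prop :=
  measurable_fun setT f /\
  (\int[mu]_x (rho x * `|f x| ^+ 2)%:E < +oo)%E.

(* "For a.e. x, y" is iterated. It holds when the exceptional set of pairs is
   contained in (N `*` setT) `|` (setT `*` N) for a null set N and, for
   sigma-finite mu, when that set is null for the product measure. Iterating
   needs no sigma-finiteness assumption, without which the product measure is
   not available. *)
Definition synchronous (d : measure_display) (T : measurableType d)
    (R : realType) (mu : {measure set T -> \bar R}) (q p : T -> R) : Prop :=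
  \forall x \ae mu, \forall y \ae mu, 0 <= (q x - q y) * (p x - p y).

Definition Gamma (d : measure_display) (T : measurableType d)
    (R : realType) (mu : {measure set T -> \bar R}) (rho h u v : T -> R) : R :=
  \det (block_mx
    (\int[mu]_x (rho x * u x * v x))%:M (\int[mu]_x (rho x * u x * h x))%:M
    (\int[mu]_x (rho x * v x * h x))%:M (\int[mu]_x (rho x * h x ^+ 2))%:M
    : 'M[R]_(1 + 1)).

(* Main.v *)
(** By synchronicity, the kernel
    (u(x) h(y) - u(y) h(x)) (v(x) h(y) - v(y) h(x)), with u = M g - f and
    v = f - m g, is nonnegative for almost every x and almost every y.
    Integrating it against rho(y), then against rho(x), yields
    2 Gamma(u, v) >= 0. The case u = v (which needs no synchronicity) shows that
    Gamma is positive semidefinite, so the first inequality is Cauchy-Schwarz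
    for Gamma; the second one is Gamma(u, v) >= 0, expanded by bilinearity and
    multiplied by Gamma(g, g) >= 0. *)
Require Import Defs.
From mathcomp Require Import all_boot all_order all_algebra.
From mathcomp Require Import all_classical all_reals all_analysis.
From mathcomp Require Import measurable_realfun ring lra.

Import Order.TTheory GRing.Theory Num.Theory.
Import numFieldNormedType.Exports.

Local Open Scope classical_set_scope.
Local Open Scope ring_scope.

(** For c > 0 the form is evaluated at (c, -b), where it equals c (a c - b^2). For c = 0 the claim
    is b = 0, and a second evaluation point forces it. *)
Lemma semidefinite_discriminant (R : realFieldType) (a b c : R) :
  (forall s t : R, 0 <= s ^+ 2 * a + 2 * s * t * b + t ^+ 2 * c) ->
  b ^+ 2 <= a * c.
Proof.
move=> psd.
have a0 : 0 <= a by have := psd 1 0; lra.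
have c0 : 0 <= c by have := psd 0 1; lra.
have [c_gt0|c_le0] := ltP 0 c.
  rewrite -subr_ge0 -(pmulr_rge0 _ c_gt0).
  suff -> : c * (a * c - b ^+ 2)
      = c ^+ 2 * a + 2 * c * (- b) * b + (- b) ^+ 2 * c by exact: psd.
  ring.
have c_eq0 : c = 0 by lra.
(* With c = 0 the form takes the value -(a + 2) b^2 here, which is nonnegative only if b = 0. *)
have := psd (- b) (a + 1); rewrite c_eq0 !mulr0 addr0 => psdab.
have b2 := sqr_ge0 b.
have ab2 : 0 <= a * b ^+ 2 by exact: mulr_ge0.
lra.
Qed.

(** The indices are written with [lshift] and [rshift] to match the block matrix in [Gamma]. *)
Lemma det_mx1D1 (R : comNzRingType) (A : 'M[R]_(1 + 1)) :
  \det A = A (lshift 1 0) (lshift 1 0) * A (rshift 1 0) (rshift 1 0)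
         - A (lshift 1 0) (rshift 1 0) * A (rshift 1 0) (lshift 1 0).
Proof.
rewrite (expand_det_row _ (lshift 1 0)) big_split_ord !big_ord1 /=.
rewrite /cofactor !det_mx11 !mxE.
have -> : lift (lshift 1 (0 : 'I_1)) 0 = rshift 1 0 by exact: val_inj.
have -> : lift (rshift 1 (0 : 'I_1)) 0 = lshift 1 0 by exact: val_inj.
by rewrite /=; ring.
Qed.

(** F agrees a.e. with |F|, whose extended integral is nonnegative; [fine] preserves this, sending
    +oo to 0. *)
Lemma ae_Rintegral_ge0 (d : measure_display) (T : measurableType d)
    (R : realType) (mu : {measure set T -> \bar R}) (F : T -> R) :
  measurable_fun setT F -> (\forall x \ae mu, 0 <= F x) ->
  0 <= \int[mu]_x F x.
Proof.
move=> mF F0; rewrite /Rintegral (ae_eq_integral (fun x => `|F x|%:E)) //.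
- by apply: fine_ge0; apply: integral_ge0 => x _; rewrite lee_fin.
- exact/measurable_EFinP.
- by apply/measurable_EFinP; exact: measurableT_comp.
- by apply: filterS F0 => x /ger0_norm Fx _; rewrite Fx.
Qed.

Section WeightedInnerProduct.
Context {d : measure_display} {T : measurableType d} {R : realType}.
Context {mu : {measure set T -> \bar R}} {rho : T -> R}.
Context (rho_meas : measurable_fun setT rho) (rho_gt0 : forall x, 0 < rho x).

Definition ip (u v : T -> R) : R := \int[mu]_x (rho x * u x * v x).

Lemma measurable_ip {u v : T -> R} :
  weightedL2 mu rho u -> weightedL2 mu rho v ->
  measurable_fun setT (fun x => rho x * u x * v x).
Proof.
by move=> [mu_ _] [mv _]; apply: measurable_funM => //; exact: measurable_funM.
Qed.

(** Links the absolute value in the definition of integrability to the integrand in [weightedL2]. *)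
Lemma integral_weighted_sqr_abs (u : T -> R) :
  (\int[mu]_x `|(rho x * u x ^+ 2)%:E| =
   \int[mu]_x (rho x * `|u x| ^+ 2)%:E)%E.
Proof.
apply: eq_integral => x _ /=; congr EFin.
by rewrite real_normK ?num_real// ger0_norm// mulr_ge0 ?sqr_ge0// ltW.
Qed.

Lemma weightedL2_integrable {u : T -> R} : weightedL2 mu rho u ->
  mu.-integrable setT (EFin \o (fun x => rho x * u x ^+ 2)).
Proof.
move=> [mu_ fin]; apply/integrableP; split.
  by apply/measurable_EFinP; apply: measurable_funM => //; exact: measurable_funX.
by rewrite /= integral_weighted_sqr_abs.
Qed.

(** Domination by rho u^2 + rho v^2, since |u v| <= 2 |u v| <= u^2 + v^2. *)
Lemma ip_integrable {u v : T -> R} :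
  weightedL2 mu rho u -> weightedL2 mu rho v ->
  mu.-integrable setT (EFin \o (fun x => rho x * u x * v x)).
Proof.
move=> Lu Lv.
have := integrableD measurableT (weightedL2_integrable Lu) (weightedL2_integrable Lv).
apply: le_integrable => //; first exact/measurable_EFinP/measurable_ip.
move=> x _ /=; rewrite lee_fin -mulrDr -mulrA !normrM.
apply: ler_wpM2l => //.
rewrite [leRHS]ger0_norm ?addr_ge0 ?sqr_ge0//.
rewrite -(real_normK (num_real (u x))) -(real_normK (num_real (v x))).
have := sqr_ge0 (`|u x| - `|v x|); have := mulr_ge0 (normr_ge0 (u x)) (normr_ge0 (v x)).
by nra.
Qed.

Lemma weightedL2_lin {u v : T -> R} (a b : R) :
  weightedL2 mu rho u -> weightedL2 mu rho v ->
  weightedL2 mu rho (fun x => a * u x + b * v x).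
Proof.
move=> Lu Lv; have [mu_ _] := Lu; have [mv _] := Lv; split.
  by apply: measurable_funD; apply: measurable_funM => //; exact: measurable_cst.
have : mu.-integrable setT (EFin \o (fun x => rho x * (a * u x + b * v x) ^+ 2)).
  have iuu := integrableZl measurableT (a ^+ 2) (weightedL2_integrable Lu).
  have ivv := integrableZl measurableT (b ^+ 2) (weightedL2_integrable Lv).
  have iuv := integrableZl measurableT (2 * a * b) (ip_integrable Lu Lv).
  have := integrableD measurableT (integrableD measurableT iuu ivv) iuv.
  apply: eq_integrable => // x _ /=; rewrite -!EFinM -!EFinD; congr EFin; ring.
by move=> /integrableP[_] /=; rewrite integral_weighted_sqr_abs.
Qed.

Lemma ipC (u v : T -> R) : ip u v = ip v u.
Proof. by apply: eq_Rintegral => x _; ring. Qed.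

Lemma ip_linr {u v w : T -> R} (a b : R) :
  weightedL2 mu rho u -> weightedL2 mu rho v -> weightedL2 mu rho w ->
  ip u (fun x => a * v x + b * w x) = a * ip u v + b * ip u w.
Proof.
move=> Lu Lv Lw; rewrite /ip.
have iv := ip_integrable Lu Lv; have iw := ip_integrable Lu Lw.
rewrite -!RintegralZl// -RintegralD//.
- by apply: eq_Rintegral => x _; ring.
- exact: (integrableZl measurableT a iv).
- exact: (integrableZl measurableT b iw).
Qed.

Lemma ip_linl {u v w : T -> R} (a b : R) :
  weightedL2 mu rho u -> weightedL2 mu rho v -> weightedL2 mu rho w ->
  ip (fun x => a * v x + b * w x) u = a * ip v u + b * ip w u.
Proof. by move=> Lu Lv Lw; rewrite ipC ip_linr// !(ipC u). Qed.

Lemma ip_ge0 {u v : T -> R} : weightedL2 mu rho u -> weightedL2 mu rho v ->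
  (\forall x \ae mu, 0 <= u x * v x) -> 0 <= ip u v.
Proof.
move=> Lu Lv uv0; apply: ae_Rintegral_ge0; first exact: measurable_ip.
apply: filterS uv0 => x uvx; rewrite -mulrA mulr_ge0//; exact: ltW.
Qed.

Context {h : T -> R} (hL2 : weightedL2 mu rho h).
Local Notation G := (Gamma mu rho h).

Lemma GammaE (u v : T -> R) : G u v = ip u v * ip h h - ip u h * ip v h.
Proof.
rewrite /Gamma det_mx1D1 block_mxEul block_mxEdr block_mxEur block_mxEdl.
rewrite !mxE !eqxx !mulr1n; congr (_ * _ - _ * _).
by apply: eq_Rintegral => x _; rewrite expr2 mulrA.
Qed.

Lemma GammaC (u v : T -> R) : G u v = G v u.
Proof. by rewrite !GammaE (ipC u v); ring. Qed.

Lemma Gamma_linr {u v w : T -> R} (a b : R) :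
  weightedL2 mu rho u -> weightedL2 mu rho v -> weightedL2 mu rho w ->
  G u (fun x => a * v x + b * w x) = a * G u v + b * G u w.
Proof. by move=> Lu Lv Lw; rewrite !GammaE ip_linr// ip_linl//; ring. Qed.

Lemma Gamma_linl {u v w : T -> R} (a b : R) :
  weightedL2 mu rho u -> weightedL2 mu rho v -> weightedL2 mu rho w ->
  G (fun x => a * v x + b * w x) u = a * G v u + b * G w u.
Proof. by move=> Lu Lv Lw; rewrite GammaC Gamma_linr// !(GammaC u). Qed.

(** Both integrations of the kernel are carried out by bilinearity of [ip], one variable at a time,
    so no Fubini argument enters. *)
Lemma Gamma_ge0 {u v : T -> R} :
  weightedL2 mu rho u -> weightedL2 mu rho v ->
  (\forall x \ae mu, \forall y \ae mu,
    0 <= (u x * h y - u y * h x) * (v x * h y - v y * h x)) ->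
  0 <= G u v.
Proof.
move=> Lu Lv ker0.
(* Chosen so that, for fixed x, the integral of the kernel against rho(y) is u(x) p(x) + h(x)
   q(x). *)
pose p x := ip h h * v x + (- ip h v) * h x.
pose q x := ip u v * h x + (- ip u h) * v x.
have Lp : weightedL2 mu rho p by exact: weightedL2_lin.
have Lq : weightedL2 mu rho q by exact: weightedL2_lin.
have inner : \forall x \ae mu, 0 <= u x * p x + h x * q x.
  apply: filterS ker0 => x kerx.
  have Lux := weightedL2_lin (u x) (- h x) hL2 Lu.
  have Lvx := weightedL2_lin (v x) (- h x) hL2 Lv.
  have : 0 <= ip (fun y => u x * h y + - h x * u y)
                 (fun y => v x * h y + - h x * v y).
    by apply: ip_ge0 => //; apply: filterS kerx => y; rewrite !mulNr ![h x * _]mulrC.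
  rewrite ip_linr// !ip_linl// /p /q [ip u h]ipC.
  lra.
(* This sum is the integral against rho(x), and equals 2 Gamma(u, v). *)
have : 0 <= ip u p + ip h q.
  rewrite /ip -RintegralD//; [|exact: ip_integrable..].
  apply: ae_Rintegral_ge0.
    by apply: measurable_funD; exact: measurable_ip.
  apply: filterS inner => x inx; rewrite -!mulrA -mulrDr mulr_ge0//; exact: ltW.
rewrite /p /q !ip_linr// GammaE (ipC h v); lra.
Qed.

Lemma Gamma_self_ge0 {u : T -> R} : weightedL2 mu rho u -> 0 <= G u u.
Proof.
by move=> Lu; apply: Gamma_ge0 => //; do 2!apply: aeW => ?; rewrite -expr2 sqr_ge0.
Qed.

Lemma Gamma_cauchy_schwarz {u v : T -> R} :
  weightedL2 mu rho u -> weightedL2 mu rho v -> G u v ^+ 2 <= G u u * G v v.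
Proof.
move=> Lu Lv; apply: semidefinite_discriminant => s t.
(* The quadratic form in s and t is Gamma(w, w) for w = s u + t v. *)
have Lw := weightedL2_lin s t Lu Lv.
have := Gamma_self_ge0 Lw.
rewrite Gamma_linr// !Gamma_linl// (GammaC v u).
lra.
Qed.

End WeightedInnerProduct.

Theorem proposition1 (d : measure_display) (T : measurableType d)
    (R : realType) (mu : {measure set T -> \bar R})
    (rho : T -> R) (rho_meas : measurable_fun setT rho)
    (rho_gt0 : forall x, 0 < rho x)
    (m M : R) (m_gt0 : 0 < m) (m_lt_M : m < M)
    (f g h : T -> R)
    (fL2 : weightedL2 mu rho f) (gL2 : weightedL2 mu rho g)
    (hL2 : weightedL2 mu rho h)
    (h_neq0 : \forall x \ae mu, h x != 0)
    (sync : synchronous mu (fun x => M * (g x / h x) - f x / h x)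
                           (fun x => f x / h x - m * (g x / h x))) :
  let G := Gamma mu rho h in
  [/\ 0 <= G f f * G g g - G f g ^+ 2,
      G f f * G g g - G f g ^+ 2 <=
        1 / 4 * (M - m) ^+ 2 * G g g ^+ 2
          - `|(m + M) / 2 * G g g - G f g| ^+ 2
    & 1 / 4 * (M - m) ^+ 2 * G g g ^+ 2
          - `|(m + M) / 2 * G g g - G f g| ^+ 2
        <= 1 / 4 * (M - m) ^+ 2 * G g g ^+ 2].
Proof.
move=> G; split.
- rewrite subr_ge0; exact: Gamma_cauchy_schwarz.
(* These are h times the two synchronous functions wherever h is nonzero, written in the shape that
   the linearity lemmas match. *)
- pose u x := M * g x + - 1 * f x; pose v x := 1 * f x + (- m) * g x.
  have Lu : weightedL2 mu rho u by exact: weightedL2_lin.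
  have Lv : weightedL2 mu rho v by exact: weightedL2_lin.
  have : 0 <= G u v.
    apply: Gamma_ge0 => //; move: sync; rewrite /synchronous.
    apply: filterS2 (h_neq0) => x hx; apply: filterS2 (h_neq0) => y hy syncxy.
    (* As h(x) and h(y) are nonzero, each factor of the kernel is h(x) h(y) times a difference of
       quotients. *)
    suff -> : (u x * h y - u y * h x) * (v x * h y - v y * h x) =
      (h x * h y) ^+ 2 *
      ((M * (g x / h x) - f x / h x - (M * (g y / h y) - f y / h y)) *
       (f x / h x - m * (g x / h x) - (f y / h y - m * (g y / h y)))).
      by rewrite mulr_ge0 ?sqr_ge0.
    by rewrite /u /v; field; rewrite hx hy.
  rewrite /G /u /v Gamma_linr// !Gamma_linl// (GammaC g f) -/G => uv0.
  rewrite real_normK ?num_real// -subr_ge0.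
  (* The right side minus the left side is exactly Gamma(g, g) Gamma(u, v), where Gamma(u, v) = (m +
     M) Gamma(f, g) - m M Gamma(g, g) - Gamma(f, f). *)
  apply: le_trans (mulr_ge0 (Gamma_self_ge0 rho_meas rho_gt0 hL2 gL2) uv0) _.
  by rewrite -/G le_eqVlt; apply/orP; left; apply/eqP; field.
- by rewrite lerBlDr lerDl exprn_ge0.
Qed.
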